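(* The threshold bias for the Hamiltonicity game $\mathcal{H}(S_b,n)$ is $\Theta(n)$.
   Context: $\mathcal{H}(S_b,n)$ is the following game on the edge set of $K_n$ ($n$ large): players alternate; on each turn Maker claims one unclaimed edge, and Breaker claims a set of at most $b$ unclaimed edges all incident to a common vertex (a subgraph of a star with $b$ leaves). The game ends when no unclaimed edges remain. Maker wins if her graph contains a Hamiltonian path of $K_n$; otherwise Breaker wins. The threshold bias is the value $b_0(n)$ such that Breaker wins if $b>b_0$ and Maker wins if $b\le b_0$. Convention: when considering Maker strategies Breaker makes the first move, and when considering Breaker strategies Maker makes the first move. *)

(* Defs.v *)
From mathcomp Require Import all_boot.

Set Implicit Arguments.
Unset Strict Implicit.
Unset Printing Implicit Defensive.

Inductive player := Maker | Breaker.

Section Game.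

Variable n : nat.

(* A graph on the vertex set 'I_n is the set of its edges, an edge being a
   two-element set of vertices. *)
Definition graph := {set {set 'I_n}}.

Definition complete_graph : graph := [set e : {set 'I_n} | #|e| == 2].

Definition has_ham_path (G : graph) : Prop :=
  exists p : seq 'I_n,
    [/\ uniq p, (forall v, v \in p) & sorted (fun x y => [set x; y] \in G) p].

Definition unclaimed (M B : graph) : graph := complete_graph :\: (M :|: B).

Definition breaker_move (b : nat) (M B S : graph) : Prop :=
  [/\ S \subset unclaimed M B, #|S| <= b
    & exists v : 'I_n, forall e, e \in S -> v \in e].

(* [maker_wins b t M B]: Maker has a winning strategy in the game of bias b
   from the position where she owns M, Breaker owns B and t is to move; a
   derivation is a strategy tree.  Breaker may claim the empty set, but every
   turn of Maker uses up an edge, so each play is finite. *)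
Inductive maker_wins (b : nat) : player -> graph -> graph -> Prop :=
| MakerWinsEnd t M B :
    unclaimed M B = set0 -> has_ham_path M -> maker_wins b t M B
| MakerWinsMaker M B e :
    e \in unclaimed M B -> maker_wins b Breaker (e |: M) B ->
    maker_wins b Maker M B
| MakerWinsBreaker M B :
    unclaimed M B != set0 ->
    (forall S, breaker_move b M B S -> maker_wins b Maker M (S :|: B)) ->
    maker_wins b Breaker M B.

Inductive breaker_wins (b : nat) : player -> graph -> graph -> Prop :=
| BreakerWinsEnd t M B :
    unclaimed M B = set0 -> ~ has_ham_path M -> breaker_wins b t M B
| BreakerWinsMaker M B :
    unclaimed M B != set0 ->
    (forall e, e \in unclaimed M B -> breaker_wins b Breaker (e |: M) B) ->
    breaker_wins b Maker M B
| BreakerWinsBreaker M B S :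
    unclaimed M B != set0 -> breaker_move b M B S ->
    breaker_wins b Maker M (S :|: B) ->
    breaker_wins b Breaker M B.

End Game.

Definition maker_wins_ham (first : player) (b n : nat) : Prop :=
  maker_wins b first (set0 : graph n) set0.

Definition breaker_wins_ham (first : player) (b n : nat) : Prop :=
  breaker_wins b first (set0 : graph n) set0.

(* The player who moves first is a parameter: the threshold with Breaker first
   governs the strategies of Maker, the one with Maker first those of Breaker. *)
Definition is_threshold_bias (first : player) (n b0 : nat) : Prop :=
  forall b : nat, (b0 < b -> breaker_wins_ham first b n) /\
                  (b <= b0 -> maker_wins_ham first b n).

(* Main.v *)
Require Import Defs.
From mathcomp Require Import all_boot.
From mathcomp Require Import zify.
From mathcomp Require boolp.

Set Implicit Arguments.
Unset Strict Implicit.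
Unset Printing Implicit Defensive.

(* For b >= n Breaker claims all edges at a vertex that Maker has not touched.
   For b <= n / 1000 Maker keeps an ordering of the vertices and a set F of her
   edges joining consecutive vertices, that is, a linear forest, and she builds
   it up to a Hamiltonian path in O(n) turns.

   Suppose first that all path ends have Breaker degree below n / 10.  Maker cuts
   the ordering at a missing edge into h ... l and ... a, the first part being the
   longer, and picks consecutive x, c, y inside it such that ac, hy, lx are not
   Breaker's.  She claims ac.  As hy and lx are disjoint, a star cannot block
   both; with hy she trades cy for ac and hy, with lx she trades cx for ac and
   lx, and in both cases the forest gains an edge and no vertex loses degree.

   If some path end is dangerous, i.e. has Breaker degree at least n / 10, Maker
   gives a dangerous end one more edge by a rotation that only exposes a
   non-dangerous vertex, choosing the centre of Breaker's last star if that is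
   dangerous.  Breaker claims O(bn) edges in all, so only O(b) vertices are ever
   dangerous and they cost O(b) turns; during these, a dangerous end gains at
   most b edges from each star centred at it, which is answered at once, and one
   from any other star.  Hence all path ends keep Breaker degree well below n. *)

(** * Play from arbitrary positions: monotonicity, determinacy, isolated vertices *)

Section Positions.

Variables (n b : nat).
Implicit Types (M B S : graph n) (e : {set 'I_n}).

Lemma unclaimedU1 e M B : unclaimed (e |: M) B = unclaimed M B :\ e.
Proof.
apply/setP=> x; rewrite !inE; case: (x == e) => //=; by rewrite andbF.
Qed.

Lemma breaker_move0 (v : 'I_n) M B : breaker_move b M B set0.
Proof. by split; rewrite ?sub0set ?cards0 //; exists v => e; rewrite inE. Qed.

Lemma has_ham_pathS M M' : M \subset M' -> has_ham_path M -> has_ham_path M'.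
Proof.
move=> /subsetP sM [p [pu pall ps]]; exists p; split=> //.
by apply: sub_sorted ps => x y /sM.
Qed.

Lemma unclaimedU S M B : unclaimed M (S :|: B) = unclaimed M B :\: S.
Proof. by apply/setP=> x; rewrite !inE !negb_or; do ! case: (x \in _). Qed.

(** The play goes on until the board is full, but a Hamiltonian path survives any further edges, so
    Maker may finish with arbitrary moves. *)
Lemma ham_path_maker_wins t M B : has_ham_path M -> maker_wins b t M B.
Proof.
have [k] := ubnP #|unclaimed M B|.
elim: k t M B => // k IH t M B; rewrite ltnS => lek hM.
(* Breaker may pass, so only Maker's moves surely decrease the measure; her turn is settled first
   and reused after his. *)
have maker_turn B' : #|unclaimed M B'| <= k -> maker_wins b Maker M B'.
  move=> lek'; have [U0|[e eU]] := set_0Vmem (unclaimed M B').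
    exact: MakerWinsEnd.
  apply: (MakerWinsMaker eU); apply: IH.
    by rewrite unclaimedU1; rewrite (cardsD1 e) eU in lek'.
  by apply: has_ham_pathS hM; rewrite subsetUr.
case: t; first exact: maker_turn.
have [U0|UN] := eqVneq (unclaimed M B) set0; first exact: MakerWinsEnd.
apply: MakerWinsBreaker => // S _; apply: maker_turn.
by rewrite unclaimedU (leq_trans _ lek) // subset_leq_card // subsetDl.
Qed.

(* Claiming an edge that Maker already owns is harmless: she keeps the turn,
   which amounts to Breaker having passed. *)
Lemma maker_claim (v : 'I_n) e M B :
  #|e| = 2 -> e \notin B ->
  (forall S, breaker_move b (e |: M) B S ->
     maker_wins b Maker (e |: M) (S :|: B)) ->
  maker_wins b Maker M B.
Proof.
move=> e2 eB win; have := win _ (breaker_move0 v (e |: M) B); rewrite set0U => win0.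
have [eM|eM] := boolP (e \in M).
  by rewrite (setUidPr _) ?sub1set in win0.
have eU : e \in unclaimed M B by rewrite !inE e2 (negPf eM) (negPf eB).
apply: (MakerWinsMaker eU).
(* If [e] was the last edge, Breaker has no turn, but then [win0] can only come from a final
   position. *)
have [U0|UN] := eqVneq (unclaimed (e |: M) B) set0; last exact: MakerWinsBreaker.
by inversion win0; subst; [exact: MakerWinsEnd | rewrite U0 inE in H].
Qed.

(** Backward induction on the number of unclaimed edges. It gives Maker the biases between the range
    of her explicit strategy and the least bias found for Breaker. *)
Lemma determinacy t M B : 0 < n -> maker_wins b t M B \/ breaker_wins b t M B.
Proof.
move=> n0; have v : 'I_n by case: (n) n0 => // m _; exact: ord0.
have [k] := ubnP #|unclaimed M B|.
elim: k t M B => // k IH t M B; rewrite ltnS => lek.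
have fin t' B' : unclaimed M B' = set0 ->
    maker_wins b t' M B' \/ breaker_wins b t' M B'.
  move=> U0; case: (boolp.EM (has_ham_path M)) => h.
    by left; exact: MakerWinsEnd.
  by right; exact: BreakerWinsEnd.
have maker_turn B' : #|unclaimed M B'| <= k ->
    maker_wins b Maker M B' \/ breaker_wins b Maker M B'.
  move=> lek'; have [U0|UN] := eqVneq (unclaimed M B') set0; first exact: fin.
  case: (boolp.EM
    (exists2 e, e \in unclaimed M B' & maker_wins b Breaker (e |: M) B')).
    by case=> e eU eW; left; exact: MakerWinsMaker eU eW.
  move=> nW; right; apply: BreakerWinsMaker => // e eU.
  have [|W|//] := IH Breaker (e |: M) B'; last by case: nW; exists e.
  by rewrite unclaimedU1; rewrite (cardsD1 e) eU in lek'.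
case: t; first exact: maker_turn.
have [U0|UN] := eqVneq (unclaimed M B) set0; first exact: fin.
case: (boolp.EM
  (exists2 S, breaker_move b M B S & breaker_wins b Maker M (S :|: B))).
  by case=> S SU SW; right; exact: BreakerWinsBreaker SU SW.
move=> nW; left; apply: MakerWinsBreaker => // S SU.
have [|//|W] := maker_turn (S :|: B); last by case: nW; exists S.
by rewrite unclaimedU (leq_trans _ lek) // subset_leq_card // subsetDl.
Qed.

Lemma breaker_winsW b' t M B :
  b <= b' -> breaker_wins b t M B -> breaker_wins b' t M B.
Proof.
move=> leb; elim=> {t M B}.
- by move=> t M B U0 h; exact: BreakerWinsEnd.
- by move=> M B UN _ IH; exact: BreakerWinsMaker.
- move=> M B S UN [SU Sb Sv] _ IH; apply: BreakerWinsBreaker IH => //.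
  by split=> //; exact: leq_trans leb.
Qed.

Lemma isolated_no_ham_path (v : 'I_n) M :
  1 < n -> (forall w, [set v; w] \notin M) -> ~ has_ham_path M.
Proof.
move=> n1 vM [p [pu pall ps]].
have sp : size p = n.
  by rewrite -[RHS]card_ord; apply/eqP; rewrite eqn_leq -{1}(card_uniqP pu)
    max_card -(card_uniqP pu) subset_leq_card //; apply/subsetP=> x _; exact: pall.
have /splitPr pE := pall v; case: pE sp ps => p1 p2; rewrite size_cat /= => sp.
case: p2 sp => [|w p2] sp.
  case/lastP: p1 sp => [|p1 w] /=; first by lia.
  move=> _; rewrite cat_rcons => /cat_sorted2[_] /= /andP[].
  by rewrite setUC (negPf (vM w)).
by move=> /cat_sorted2[_] /= /andP[]; rewrite (negPf (vM w)).
Qed.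

(** Maker can never reach [v], so Breaker passes for the rest of the play. *)
Lemma isolated_breaker_wins (v : 'I_n) t M B :
  1 < n -> (forall w, [set v; w] \notin M) ->
  (forall w, w != v -> [set v; w] \in B) -> breaker_wins b t M B.
Proof.
move=> n1; have [k] := ubnP #|unclaimed M B|.
elim: k t M B => // k IH t M B; rewrite ltnS => lek vM vB.
have maker_turn : breaker_wins b Maker M B.
  have [U0|UN] := eqVneq (unclaimed M B) set0.
    by apply: BreakerWinsEnd => //; exact: isolated_no_ham_path vM.
  apply: BreakerWinsMaker => // e eU; apply: IH => //.
    by rewrite unclaimedU1; rewrite (cardsD1 e) eU in lek.
  move=> w; rewrite !inE negb_or vM andbT; apply/eqP=> ew; move: eU.
  rewrite !inE -ew cards2; have [->|wv] := eqVneq w v; first by rewrite andbF.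
  by rewrite vB // orbT.
case: t => //; have [U0|UN] := eqVneq (unclaimed M B) set0.
  by apply: BreakerWinsEnd => //; exact: isolated_no_ham_path vM.
apply: (@BreakerWinsBreaker _ _ _ _ set0) => //; first exact: breaker_move0.
by rewrite set0U.
Qed.

Lemma breaker_isolates (v : 'I_n) M :
  1 < n -> n <= b -> (forall w, [set v; w] \notin M) ->
  breaker_wins b Breaker M set0.
Proof.
move=> n1 nb vM.
pose S : graph n := [set [set v; w] | w in [set~ v]].
have SU : S \subset unclaimed M set0.
  apply/subsetP=> _ /imsetP[w wv ->]; rewrite !inE (negPf (vM w)) cards2.
  by move: wv; rewrite !inE eq_sym => ->.
have inS w : w != v -> [set v; w] \in S by move=> wv; apply: imset_f; rewrite !inE.
apply: (@BreakerWinsBreaker _ _ _ _ S).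
- have /set0Pn[w] : [set~ v] != set0 by rewrite -card_gt0 cardsC1 card_ord; lia.
  rewrite !inE => wv; apply/set0Pn; exists [set v; w]; exact: (subsetP SU) (inS _ wv).
- split=> //.
    by rewrite (leq_trans (leq_imset_card _ _)) // cardsC1 card_ord; lia.
  by exists v => _ /imsetP[w _ ->]; rewrite !inE eqxx.
- by apply: (@isolated_breaker_wins v) => // w wv; rewrite setU0 inS.
Qed.

End Positions.

(** If Maker starts, [2 < n] leaves a vertex outside her first edge, which Breaker isolates at
    once. *)
Lemma breaker_wins_large first n b : 2 < n -> n <= b -> breaker_wins_ham first b n.
Proof.
move=> n2 nb; have o : 'I_n by exists 0; lia.
case: first; last first.
  by apply: (@breaker_isolates _ _ o) => // [|w]; rewrite ?inE //; lia.
rewrite /breaker_wins_ham; apply: BreakerWinsMaker.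
  have l0 : 0 < n by lia. have l1 : 1 < n by lia.
  by apply/set0Pn; exists [set Ordinal l0; Ordinal l1]; rewrite !inE cards2.
move=> e; rewrite !inE => /eqP e2.
have /set0Pn[v] : ~: e != set0 by rewrite -card_gt0 cardsCs setCK card_ord; lia.
rewrite !inE => ve; apply: (@breaker_isolates _ _ v) => // [|w]; first by lia.
by rewrite !inE orbF; apply: contraNneq ve => <-; rewrite !inE eqxx.
Qed.

(** * Pairs of consecutive entries of a sequence *)

Section Links.

Variable T : finType.
Implicit Types (p q A D : seq T) (e : {set T}).

Fixpoint links p : seq {set T} :=
  if p is x :: p' then
    if p' is y :: _ then [set x; y] :: links p' else [::]
  else [::].

Lemma links_cat A x y D :
  links (A ++ x :: y :: D) = links (rcons A x) ++ [set x; y] :: links (y :: D).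
Proof. by elim: A => //= z [|w A] IH //=; rewrite -IH. Qed.

Lemma links_rcons A x y :
  links (rcons (rcons A x) y) = rcons (links (rcons A x)) [set x; y].
Proof. by rewrite -cats1 cat_rcons links_cat cats1. Qed.

Lemma links_rev p : links (rev p) =i links p.
Proof.
move=> e; elim: p => //= x [|y p] IH //.
by rewrite 2!rev_cons links_rcons -rev_cons mem_rcons !inE IH setUC.
Qed.

Lemma mem_links_catP e A D :
  e \in links (A ++ D) ->
  [\/ e \in links A, e \in links D |
      exists A' x y D', [/\ A = rcons A' x, D = y :: D' & e = [set x; y]]].
Proof.
case/lastP: A => [|A x]; first by move=> eD; constructor 2.
case: D => [|y D]; first by rewrite cats0 => eA; constructor 1.
rewrite cat_rcons links_cat mem_cat inE => /or3P[].
- by constructor 1.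
- by move/eqP=> eE; constructor 3; exists A, x, y, D.
- by constructor 2.
Qed.

Lemma links_catl e A D : e \in links A -> e \in links (A ++ D).
Proof.
case/lastP: A => // A x; case: D => [|y D]; first by rewrite cats0.
by rewrite cat_rcons links_cat mem_cat => ->.
Qed.

Lemma links_catr e A D : e \in links D -> e \in links (A ++ D).
Proof.
case/lastP: A => // A x; case: D => [|y D] //.
by rewrite cat_rcons links_cat mem_cat inE => ->; rewrite !orbT.
Qed.

Lemma links_mid A x y D : [set x; y] \in links (A ++ x :: y :: D).
Proof. by rewrite links_cat mem_cat inE eqxx orbT. Qed.

Lemma links_sub e p x : e \in links p -> x \in e -> x \in p.
Proof.
elim: p => //= y [|z p] IH //; rewrite inE => /orP[/eqP->|/IH h /h].
  by rewrite !inE => /orP[]->; rewrite ?orbT.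
by rewrite [in X in _ -> X]inE => ->; rewrite orbT.
Qed.

Lemma links_head e x y p :
  uniq (x :: y :: p) -> e \in links (x :: y :: p) -> x \in e -> e = [set x; y].
Proof.
move=> /andP[xN _]; rewrite [links _]/= -/(links (y :: p)) inE => /orP[/eqP//|eL xe].
by rewrite (links_sub eL xe) in xN.
Qed.

Lemma links_last e p y x :
  uniq (p ++ [:: y; x]) -> e \in links (p ++ [:: y; x]) -> x \in e -> e = [set x; y].
Proof.
by rewrite -rev_uniq -links_rev rev_cat; exact: links_head.
Qed.

End Links.

Lemma sorted_splitP (T : Type) (r : rel T) (p : seq T) :
  sorted r p \/ exists A x y D, p = A ++ x :: y :: D /\ ~~ r x y.
Proof.
elim: p => [|x [|y p] IH]; [by left | by left |].
have [rxy|nrxy] := boolP (r x y); last by right; exists [::], x, y, p.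
case: IH => [s|[A [u [v [D [-> nr]]]]]]; first by left; rewrite /= rxy.
by right; exists (x :: A), u, v, D.
Qed.

(** * Degrees, and linear forests arranged along a sequence *)

Section Degrees.

Variable n : nat.
Implicit Types (F G B S : graph n) (e f : {set 'I_n}) (p : seq 'I_n).

Definition deg F (v : 'I_n) := #|[set e in F | v \in e]|.

Lemma degU1 e F v : e \notin F -> deg (e |: F) v = (v \in e) + deg F v.
Proof.
move=> eF; rewrite /deg; have [ve|ve] := boolP (v \in e).
  rewrite (cardsD1 e) !inE eqxx ve /=; congr (_ + #|pred_of_set _|).
  apply/setP=> f; rewrite !inE; have [->|] := eqVneq f e => //=.
  by rewrite (negPf eF).
congr #|pred_of_set _|; apply/setP=> f; rewrite !inE.
by have [->|] := eqVneq f e => //=; rewrite (negPf ve) andbF.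
Qed.

Lemma degD1 f F v : deg F v = (f \in F) && (v \in f) + deg (F :\ f) v.
Proof.
have [fF|fF] := boolP (f \in F); first by rewrite -{1}(setD1K fF) degU1 ?inE ?eqxx.
by rewrite (setDidPl _) // disjoint_sym disjoints1.
Qed.

Lemma deg_leU F G v : deg (F :|: G) v <= deg F v + deg G v.
Proof.
rewrite /deg (leq_trans _ (leq_card_setU _ _)) // subset_leq_card //.
by apply/subsetP=> e; rewrite !inE => /andP[/orP[]-> ->]; rewrite ?orbT.
Qed.

Lemma deg_subset F G v : F \subset G -> deg F v <= deg G v.
Proof.
move=> /subsetP FG; apply: subset_leq_card; apply/subsetP=> e.
by rewrite !inE => /andP[/FG-> ->].
Qed.

Lemma deg_leq_card F v : deg F v <= #|F|.
Proof. by apply: subset_leq_card; apply/subsetP=> e; rewrite inE => /andP[]. Qed.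

(** An edge of the star at [v] also contains the centre [z], so it can only be the pair of the
    two. *)
Lemma deg_star_leaf S z v :
  S \subset complete_graph n -> (forall e, e \in S -> z \in e) -> v != z ->
  deg S v <= 1.
Proof.
move=> /subsetP Sc zS vz; rewrite /deg -(cards1 [set v; z]).
apply: subset_leq_card; apply/subsetP=> e; rewrite !inE => /andP[eS ve].
have := Sc _ eS; rewrite inE => e2; rewrite eq_sym eqEcard (eqP e2) cards2 vz andbT.
by apply/subsetP=> x; rewrite !inE => /orP[]/eqP-> //; exact: zS.
Qed.

(** Handshake lemma, by double counting of incidences. *)
Lemma sum_deg B : B \subset complete_graph n -> \sum_v deg B v = 2 * #|B|.
Proof.
move=> /subsetP Bc.
transitivity (\sum_v \sum_(e in B) (v \in e : nat)).
  apply: eq_bigr => v _; rewrite /deg -sum1_card big_mkcond [RHS]big_mkcond /=.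
  by apply: eq_bigr => e _; rewrite inE; case: (e \in B).
rewrite exchange_big /= mulnC -sum_nat_const; apply: eq_bigr => e /Bc.
by rewrite inE => /eqP<-; rewrite -sum1_card [RHS]big_mkcond.
Qed.

Definition nbrs B v := [set x | [set v; x] \in B].

Lemma pair_set_inj (T : finType) (v : T) : injective (fun x => [set v; x]).
Proof.
move=> x y /setP xy; have /esym := xy x; have := xy y; rewrite !inE !eqxx !orbT.
by move=> /orP[/eqP->|/eqP->//] /orP[]/eqP.
Qed.

Lemma card_nbrs B v : #|nbrs B v| <= deg B v.
Proof.
rewrite /deg -(card_imset _ (@pair_set_inj _ v)) subset_leq_card //.
by apply/subsetP=> _ /imsetP[x + ->]; rewrite !inE eqxx => ->.
Qed.

(* [p] lists all vertices; the edges of [F] cut it into a linear forest. *)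
Definition arranged F p :=
  [/\ uniq p, forall v, v \in p & {subset F <= links p}].

Lemma arranged_perm F F' p q :
  arranged F p -> perm_eq p q -> {subset F' <= links q} -> arranged F' q.
Proof.
move=> [pu pall _] pq Fq; split=> // [|v]; first by rewrite -(perm_uniq pq).
by rewrite -(perm_mem pq).
Qed.

Lemma arranged_size F p : arranged F p -> size p = n.
Proof.
move=> [pu pall _]; rewrite -[RHS]card_ord -(card_uniqP pu).
by apply: eq_card => v; rewrite pall.
Qed.

Lemma arranged_rev F p : arranged F p -> arranged F (rev p).
Proof.
move=> Fp; apply: (arranged_perm Fp); first by rewrite perm_sym perm_rev.
by move=> e eF; rewrite links_rev; case: Fp => _ _; apply.
Qed.

Lemma arranged_rot F A D :
  arranged F (A ++ D) -> {subset F <= links A ++ links D} -> arranged F (D ++ A).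
Proof.
move=> FAD Fl; apply: (arranged_perm FAD); first by rewrite perm_catC.
move=> e /Fl; rewrite mem_cat => /orP[]; [exact: links_catr | exact: links_catl].
Qed.

Lemma deg_head F x p : arranged F (x :: p) -> deg F x <= 1.
Proof.
move=> [pu _ Fp]; rewrite /deg -(cards1 [set x; head x p]).
apply: subset_leq_card; apply/subsetP=> e; rewrite !inE => /andP[/Fp].
by case: p pu {Fp} => // y p pu eL xe; rewrite (links_head pu eL xe).
Qed.

Lemma deg_last F x p : arranged F (rcons p x) -> deg F x <= 1.
Proof. by move/arranged_rev; rewrite rev_rcons; exact: deg_head. Qed.

Lemma deg_le2 F p v : arranged F p -> deg F v <= 2.
Proof.
move=> [pu pall Fp]; case/splitPr: (pall v) pu Fp => A D pu Fp.
(* The edges to the successor and the predecessor of [v]; at an end of the sequence the default [v]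
   gives a singleton, which does no harm in a covering set. *)
rewrite /deg (@leq_trans #|[set [set v; head v D]; [set v; last v A]]|) //;
  last by rewrite cards2; case: eqP.
apply: subset_leq_card; apply/subsetP=> e; rewrite !inE => /andP[/Fp + ve].
have uD : uniq (v :: D) by move: pu; rewrite cat_uniq => /and3P[].
have uA : uniq (rcons A v).
  by move: pu; rewrite -cat_rcons cat_uniq => /and3P[].
case: D {pu Fp} uD => [|y D] uD; case/lastP: A uA => [|A x] uA //=.
- rewrite cats1 -!cats1 -catA last_cat /= => eL; rewrite -!cats1 -catA in uA.
  by rewrite (links_last uA eL ve) eqxx orbT.
- by move=> eL; rewrite (links_head uD eL ve) eqxx.
- rewrite links_cat mem_cat inE last_rcons -cats1 => /or3P[eL|/eqP->|eL].
  + rewrite -!cats1 -catA in uA eL.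
    by rewrite (links_last uA eL ve) eqxx orbT.
  + by rewrite eqxx.
  + have vx : v \notin y :: D by case/andP: uD.
    by rewrite (links_sub eL ve) in vx.
Qed.

(* A vertex of degree at most one is the end of a path of the forest, so the
   arrangement can be cut there and rearranged to end in that vertex. *)
Lemma arranged_to_last F p v :
  arranged F p -> deg F v < 2 -> exists q, arranged F (rcons q v).
Proof.
move=> Fp dv; have [pu pall Fl] := Fp; case/splitPr: (pall v) Fp pu Fl => A D Fp pu Fl.
have [DE|[w [D' DE]]] : D = [::] \/ exists w D', D = w :: D'.
  by case: D {Fp pu Fl} => [|w D]; [left | right; exists w, D].
  by move: Fp; rewrite DE cats1; exists A.
have [AE|[A' [u AE]]] : A = [::] \/ exists A' u, A = rcons A' u.
  by case/lastP: A {Fp pu Fl} => [|A u]; [left | right; exists A, u].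
  by move: Fp; rewrite AE => /arranged_rev; rewrite rev_cons; exists (rev D).
subst A D.
(* If the link after [v] is not in [F], cut there and swap the two parts. *)
have [vw|vw] := boolP ([set v; w] \in F); last first.
  exists (w :: D' ++ rcons A' u); rewrite -cat_cons rcons_cat.
  rewrite -cat_rcons in Fp; apply: (arranged_rot Fp) => e eF.
  move: (Fl e eF); rewrite links_cat !mem_cat inE => /or3P[->//|/eqP ee|->].
    by rewrite ee (negPf vw) in eF.
  by rewrite orbT.
have [uv|uv] := boolP ([set u; v] \in F).
  move: dv; rewrite ltnNge; case/negP.
  rewrite /deg (@leq_trans #|[set [set v; w]; [set v; u]]|) //.
    rewrite cards2; case: eqP => // /pair_set_inj wu.
    by move: pu; rewrite wu cat_rcons cat_uniq /= !inE eqxx orbT !andbF.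
  apply: subset_leq_card; apply/subsetP=> e.
  by rewrite !inE => /orP[]/eqP->; rewrite ?vw !inE ?eqxx // setUC uv.
(* As [v] has degree below 2, the link before it is missing, so the segment from [v] on can be
   reversed. *)
exists (rcons A' u ++ rev (w :: D')); rewrite rcons_cat -rev_cons.
apply: (arranged_perm Fp); first by rewrite perm_cat2l perm_sym perm_rev.
move=> e eF; have /mem_links_catP[eA|eD|] := Fl e eF.
- exact: links_catl.
- by apply: links_catr; rewrite links_rev.
- case=> A1 [x [y [D1 [/rcons_inj[_ <-] [<- _] ee]]]].
  by rewrite ee (negPf uv) in eF.
Qed.

End Degrees.

(** * Finding three consecutive entries outside small sets *)

Lemma card_preimset_inj (aT rT : finType) (f : aT -> rT) (R : {set rT}) :
  injective f -> #|f @^-1: R| <= #|R|.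
Proof.
move=> fI; rewrite -(card_imset _ fI) subset_leq_card //.
by apply/subsetP=> _ /imsetP[x + ->]; rewrite inE.
Qed.

(** Pigeonhole over the [size p - 2] starting positions: since [p] has no repetition, each element
    of each forbidden set excludes at most one of them. *)
Lemma consecutive_avoiding (T : finType) (p : seq T) (R1 R2 R3 : {set T}) :
  uniq p -> #|R1| + #|R2| + #|R3| + 2 < size p ->
  exists A x y z D, p = A ++ x :: y :: z :: D /\
    [/\ x \notin R1, y \notin R2 & z \notin R3].
Proof.
move=> pu szp; have x0 : T by case: p szp {pu}.
have [m mE] : exists m, m = size p - 2 by eexists.
pose f j (i : 'I_m) := nth x0 p (j + i).
have fI j : j < 3 -> injective (f j).
  move=> j3 i i' /eqP; have li := ltn_ord i.
  have li' := ltn_ord i'.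
  have l1 : j + i < size p by lia.
  have l2 : j + i' < size p by lia.
  by rewrite /f (nth_uniq _ l1 l2 pu) eqn_add2l => /eqP/val_inj.
pose bad := f 0 @^-1: R1 :|: f 1 @^-1: R2 :|: f 2 @^-1: R3.
have badm : #|bad| < m.
  have h1 := card_preimset_inj R1 (@fI 0 isT).
  have h2 := card_preimset_inj R2 (@fI 1 isT).
  have h3 := card_preimset_inj R3 (@fI 2 isT).
  have := (leq_card_setU (f 0 @^-1: R1 :|: f 1 @^-1: R2) (f 2 @^-1: R3)).1.
  have := (leq_card_setU (f 0 @^-1: R1) (f 1 @^-1: R2)).1.
  by rewrite /bad; lia.
have /set0Pn[i] : ~: bad != set0 by rewrite -card_gt0 cardsCs setCK card_ord; lia.
rewrite !inE !negb_or -andbA => /and3P[i1 i2 i3].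
have li := ltn_ord i.
exists (take i p), (f 0 i), (f 1 i), (f 2 i), (drop i.+3 p); split; last by split.
by rewrite /f -!drop_nth ?cat_take_drop //; lia.
Qed.

(** * Rearrangements of a linear forest *)

Section Exchange.

Variable n : nat.
Implicit Types (F M B S : graph n) (p A D X Y : seq 'I_n).

(* A Posa rotation: the path end [a] is joined to [c], and [d] becomes an end. *)
Lemma arranged_rotate F A c d D a :
  arranged F (A ++ c :: d :: rcons D a) ->
  arranged ([set a; c] |: (F :\ [set c; d])) (d :: rcons D a ++ c :: rev A) /\
  [set a; c] \notin F.
Proof.
move=> Fp; have [pu pall Fl] := Fp; split.
  apply: (arranged_perm Fp).
    by apply/permP=> P; rewrite -!cats1; do 3 rewrite ?(count_cat, count_rev) /=; lia.
  move=> e; rewrite !inE => /orP[/eqP->|/andP[ne /Fl]].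
    by rewrite cat_rcons -cat_cons links_mid.
  rewrite -cat_rcons => /mem_links_catP[eA|eD|].
  - by rewrite -cat_cons -rev_rcons; apply: links_catr; rewrite links_rev.
  - by rewrite -cat_cons; apply: links_catl.
  - by case=> A1 [x [y [D1 [/rcons_inj[_ <-] [<- _] ee]]]]; rewrite ee eqxx in ne.
(* The only link at the last vertex [a] goes to its predecessor, which lies in [d :: D] and so
   differs from [c]. *)
apply/negP=> /Fl; have [D2 [y DE]] : exists D2 y, d :: D = rcons D2 y.
  by exists (belast d D), (last d D); rewrite lastI.
move: pu; rewrite -rcons_cons DE -cats1 cat_rcons -cat_cons catA => pu.
move=> /(links_last pu); rewrite !inE eqxx => /(_ isT) /pair_set_inj cy.
by move: pu; rewrite cy -catA cat_uniq /= mem_cat !inE eqxx !orbT !andbF.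
Qed.

(** After [a] the first part is traversed from [c] back to [h], then from [y] on. The edge [ac] is
    new because it crosses the cut, and [hy] because the only link at [h] goes to a vertex before
    [c]. *)
Lemma arranged_insert F h X x c y Y D a :
  let A := h :: X ++ x :: c :: y :: Y in
  arranged F (A ++ rcons D a) -> {subset F <= links A ++ links (rcons D a)} ->
  let F' := [set a; c] |: ([set h; y] |: (F :\ [set c; y])) in
  [/\ arranged F' (rcons D a ++ c :: x :: rev X ++ h :: y :: Y),
      [set a; c] \notin F, [set h; y] \notin F & [set a; c] != [set h; y]].
Proof.
move=> A Fp Fl F'; have [pu _ _] := Fp.
have uA : uniq A by move: pu; rewrite cat_uniq => /and3P[].
have disj v : v \in A -> v \in rcons D a -> False.
  move: pu; rewrite cat_uniq => /and3P[_ /hasPn h1 _] vA vD.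
  by have := h1 v vD; rewrite /= vA.
have cA : c \in A by rewrite !inE mem_cat !inE eqxx !orbT.
have aD : a \in rcons D a by rewrite mem_rcons inE eqxx.
split.
- apply: (arranged_perm Fp).
    apply/permP=> P; rewrite -!cats1; do 3 rewrite ?(count_cat, count_rev) /=; lia.
  move=> e; rewrite !inE => /or3P[/eqP->|/eqP->|/andP[ne /Fl]].
  + by rewrite cat_rcons links_mid.
  + by rewrite -!cat_cons catA links_mid.
  + rewrite mem_cat => /orP[|eD]; last exact: links_catl.
    have -> : A = (h :: rcons (rcons X x) c) ++ y :: Y by rewrite /= !cat_rcons.
    move=> /mem_links_catP[eA|eD|].
    * have -> : c :: x :: rev X ++ h :: y :: Y =
          (c :: x :: rcons (rev X) h) ++ y :: Y by rewrite /= cat_rcons.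
      apply: links_catr; apply: links_catl.
      by rewrite -links_rev rev_cons !rev_rcons in eA.
    * have -> : c :: x :: rev X ++ h :: y :: Y =
          (c :: x :: rcons (rev X) h) ++ y :: Y by rewrite /= cat_rcons.
      by do 2 apply: links_catr.
    * case=> A1 [u [v [D1 [AE [<- _] ee]]]]; move: AE ne.
      by rewrite -rcons_cons => /rcons_inj[_ ->]; rewrite ee eqxx.
- apply/negP=> /Fl; rewrite mem_cat => /orP[] eL.
    by apply: (disj a) aD; apply: (links_sub eL); rewrite !inE eqxx.
  by apply: (disj c) => //; apply: (links_sub eL); rewrite !inE eqxx orbT.
- apply/negP=> /Fl; rewrite mem_cat => /orP[] eL; last first.
    by apply: (disj h); [rewrite inE eqxx | apply: (links_sub eL); rewrite !inE eqxx].
  rewrite /A in uA eL; case: (X) uA eL => [|z X'] uA eL.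
    have := links_head uA eL; rewrite !inE eqxx => /(_ isT) /pair_set_inj yx.
    by move: uA; rewrite yx /= !inE eqxx !orbT andbF.
  have := links_head uA eL; rewrite !inE eqxx => /(_ isT) /pair_set_inj yx.
  by move: uA; rewrite yx /= mem_cat !inE eqxx !orbT andbF.
- apply/eqP=> /setP/(_ a); rewrite !inE eqxx /= => /esym/orP[]/eqP E;
    apply: (disj a) aD; rewrite E !inE ?eqxx // mem_cat !inE eqxx !orbT //.
Qed.

(** Two edges come and at most [cy] goes; its loss is made up at [c] by [ac] and at [y] by [hy]. *)
Lemma exchange_improves F a c h y :
  [set a; c] \notin F -> [set h; y] \notin F -> [set a; c] != [set h; y] ->
  let F' := [set a; c] |: ([set h; y] |: (F :\ [set c; y])) in
  (forall v, deg F v <= deg F' v) /\ #|F| < #|F'|.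
Proof.
move=> acF hyF ne F'; split.
  move=> v; rewrite /F' !degU1 ?inE ?(negPf acF) ?(negPf hyF) ?(negPf ne) ?andbF //.
  rewrite (degD1 [set c; y] F v) !inE.
  by case: (_ \in F); case: (v == c); case: (v == y); case: (v == a); case: (v == h) => /=; lia.
rewrite /F' !cardsU1 !inE (negPf acF) (negPf hyF) (negPf ne) !andbF /=.
by rewrite (cardsD1 [set c; y] F) addnA ltn_add2r; case: (_ \in F).
Qed.

End Exchange.

(** * Maker's strategy for small bias *)

Section Strategy.

Variables n b : nat.
Hypothesis n_ge : 1000 <= n.
Hypothesis b_le : 1000 * b <= n.

Implicit Types (F M B S : graph n) (p A D : seq 'I_n).

Let threshold := n %/ 10.

Definition dangerous B := [set v | threshold <= deg B v].

(* Never decreases, and grows on each turn spent on a dangerous vertex, so it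
   counts those turns: it bounds the edges that Breaker's stars add meanwhile
   to a vertex other than their centre. *)
Definition secured F B := \sum_(v in dangerous B) deg F v.

(* At least the number of turns played so far: an edge gained by [F] may cost
   two turns. *)
Definition progress F B := secured F B + 2 * #|F|.

(* Holds after each move of Maker that completes a step of her strategy.  The
   term [b * deg F v] pays for Breaker's stars centred at [v], since Maker
   answers such a star with an edge at [v] as soon as [v] is dangerous. *)
Definition safe F B :=
  [/\ B \subset complete_graph n,
      forall v, deg F v < 2 ->
        deg B v < threshold + b + secured F B + b * deg F v
    & #|B| <= b * progress F B].

Definition star S :=
  [/\ S \subset complete_graph n, #|S| <= b & exists z, forall e, e \in S -> z \in e].

Lemma secured_leq F F' B B' :
  B \subset B' -> (forall v, v \in dangerous B -> deg F v <= deg F' v) ->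
  secured F B <= secured F' B'.
Proof.
move=> BB' FF'; rewrite /secured.
apply: (@leq_trans (\sum_(v in dangerous B) deg F' v)); first exact: leq_sum.
rewrite [in leqRHS](big_setID (dangerous B)) /=.
rewrite (setIidPr _) ?leq_addr //; apply/subsetP=> v; rewrite !inE => h.
exact: leq_trans h (deg_subset _ BB').
Qed.

Lemma secured_ltn F F' B B' v :
  B \subset B' -> (forall v, v \in dangerous B' -> deg F v <= deg F' v) ->
  v \in dangerous B' -> deg F v < deg F' v -> secured F B < secured F' B'.
Proof.
move=> BB' FF' vB' dv; have := @secured_leq F F B B' BB' (fun _ _ => leqnn _).
move/leq_ltn_trans; apply; rewrite /secured (bigD1 v) //= [ltnRHS](bigD1 v) //=.
by rewrite -addSn leq_add // leq_sum // => w /andP[wB' _]; exact: FF'.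
Qed.

Lemma secured_le F p B : arranged F p -> secured F B <= 2 * #|dangerous B|.
Proof.
move=> Fp; rewrite /secured mulnC -sum_nat_const; apply: leq_sum => v _.
exact: deg_le2 Fp.
Qed.

Lemma card_arranged F p : arranged F p -> #|F| <= n.
Proof.
move=> Fp; have szp := arranged_size Fp; case: Fp => _ _ Fl.
apply: (@leq_trans (size (links p))).
  rewrite cardE; apply: uniq_leq_size (enum_uniq _) _ => e.
  by rewrite mem_enum; exact: Fl.
rewrite -[leqRHS]szp; by elim: p {Fl szp} => //= x [|y p] IH //=.
Qed.

(** Makes [4 * n - progress F B] a termination measure and, through [safe], bounds the number of
    Breaker's edges. *)
Lemma progress_le F p B : arranged F p -> progress F B <= 4 * n.
Proof.
move=> Fp; have h1 := secured_le B Fp; have h2 := card_arranged Fp.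
have h3 : #|dangerous B| <= n by rewrite -[leqRHS]card_ord max_card.
by rewrite /progress; lia.
Qed.

(** Each dangerous vertex takes at least [threshold] of the [2 * #|B|] incidences. The [+ 1] leaves
    room for one star beyond the bound in [safe]. *)
Lemma card_dangerous B :
  B \subset complete_graph n -> #|B| <= b * (4 * n + 1) -> #|dangerous B| <= 200 * b.
Proof.
move=> /sum_deg dB cB.
have : #|dangerous B| * threshold <= 2 * #|B|.
  rewrite -dB -sum_nat_const [leqRHS](bigID (mem (dangerous B))) /=.
  rewrite (leq_trans _ (leq_addr _ _)) // leq_sum // => v; by rewrite inE.
have : n <= 11 * threshold by rewrite /threshold; lia.
move: (#|dangerous B|) (#|B|) cB => x y; nia.
Qed.

Lemma dangerous_step F p B S :
  arranged F p -> safe F B -> star S ->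
  (exists v, (deg F v < 2) && (v \in dangerous (S :|: B))) ->
  exists (e : {set 'I_n}) F' q,
    [/\ e \notin S :|: B, #|e| = 2, F' \subset e |: F & arranged F' q] /\
    safe F' (S :|: B) /\ progress F B < progress F' (S :|: B).
Proof.
move=> Fp [Bc Bd Bn] [Sc Sb [z zS]] exv.
set B' := S :|: B.
have BB' : B \subset B' by rewrite subsetUr.
have B'c : B' \subset complete_graph n by rewrite subUset Sc.
have cB' : #|B'| <= #|B| + b.
  by have := (leq_card_setU S B).1; rewrite -/B' => h; rewrite (leq_trans h) // addnC leq_add2l.
have leaf v : v != z -> deg B' v <= deg B v + 1.
  move=> vz; rewrite (leq_trans (deg_leU _ _ _)) // addnC leq_add2l.
  exact: deg_star_leaf vz.
have centre v : deg B' v <= deg B v + b.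
  rewrite (leq_trans (deg_leU _ _ _)) // addnC leq_add2l.
  exact: leq_trans (deg_leq_card _ _) Sb.
(* The centre takes priority, since no other vertex can have gained more than one edge from [S]. *)
have [a [da aB' za]] : exists a, [/\ deg F a < 2, a \in dangerous B' &
    (deg F z < 2) && (z \in dangerous B') -> a = z].
  case: (boolP ((deg F z < 2) && (z \in dangerous B'))) => [/andP[]|] h.
    by exists z.
  by case: exv => v /andP[dv vB']; exists v; rewrite dv vB'.
have [q Fq] := arranged_to_last Fp da.
have pB := progress_le B Fp.
have cDB : #|dangerous B'| <= 200 * b.
  apply: card_dangerous => //; rewrite (leq_trans cB') //.
  by rewrite mulnDr muln1 leq_add2r (leq_trans Bn) // leq_mul2l pB orbT.
have sB : secured F B <= 400 * b.
  have := secured_le B' Fp; have := @secured_leq F F B B' BB' (fun _ _ => leqnn _); lia.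
(* Beyond [threshold], [safe] allows [b], then [400 * b] for [secured], then [b] as [a] has degree
   at most one; the new star adds another [b]. *)
have dB'a : deg B' a < n %/ 10 + 403 * b.
  have := centre a; have := Bd a da; have : b * deg F a <= b.
    by rewrite -{2}(muln1 b) leq_mul2l -ltnS da orbT.
  by rewrite /threshold; lia.
have := arranged_size Fq => szq.
(* The unconstrained third entry only ensures that [d] is not the last vertex [a]. *)
have [||A [c [d [w [D [qE [acB' dB' _]]]]]]] :=
  @consecutive_avoiding _ (rcons q a) (nbrs B' a) (dangerous B') set0.
- by case: Fq.
- rewrite cards0 szq addn0. have h1 := leq_trans (card_nbrs B' a) (ltnW dB'a).
  rewrite (@leq_ltn_trans ((n %/ 10 + 403 * b) + 200 * b + 2)) //. rewrite leq_add2r.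
  rewrite leq_add //. lia.
have [D' [a' DE]] : exists D' a', w :: D = rcons D' a'.
  by exists (belast w D), (last w D); rewrite lastI.
move: qE; rewrite DE -rcons_cons -rcons_cons -rcons_cat => /rcons_inj[qE aE].
rewrite -aE {a' aE} in DE; rewrite qE rcons_cat !rcons_cons in Fq.
have [Fr acF] := arranged_rotate Fq.
have [uq _ _] := Fq.
have ac : a != c.
  apply/eqP=> ac; move: uq; rewrite cat_uniq /= -ac => /and3P[_ _].
  by rewrite inE mem_rcons inE eqxx orbT.
have ad : a != d.
  apply/eqP=> ad; move: uq; rewrite cat_uniq => /and3P[_ _].
  by rewrite !cons_uniq => /and3P[_ + _]; rewrite -ad mem_rcons inE eqxx.
set F' := _ |: _ in Fr.
have degF' v : deg F' v = ((v == a) || (v == c)) + deg (F :\ [set c; d]) v.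
  by rewrite /F' degU1 !inE ?(negPf acF) ?andbF.
have degF v : deg F v = ([set c; d] \in F) && ((v == c) || (v == d)) + deg (F :\ [set c; d]) v.
  by rewrite (degD1 [set c; d]) !inE.
have mono v : v != d -> deg F v <= deg F' v.
  move=> vd; rewrite degF degF' (negPf vd) orbF leq_add2r.
  by case: (_ \in F); case: (v == c); rewrite ?orbT.
have monoa : deg F a < deg F' a.
  by rewrite degF degF' eqxx (negPf ac) (negPf ad) andbF.
have monoD v : v \in dangerous B' -> deg F v <= deg F' v.
  by move=> vB'; apply: mono; apply: contraNneq dB' => <-.
have sec : secured F B < secured F' B' by apply: (secured_ltn BB' monoD aB').
have cF : #|F| <= #|F'|.
  rewrite /F' cardsU1 !inE (negPf acF) andbF (cardsD1 [set c; d] F) leq_add2r.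
  by case: (_ \in F).
have prog : progress F B < progress F' B'.
  by rewrite /progress -addSn leq_add // leq_mul2l cF.
exists [set a; c], F', (d :: rcons D' a ++ c :: rev A); split; last split=> //.
  split=> //; first by move: acB'; rewrite inE.
    by rewrite cards2 ac.
  by apply: setUS; rewrite subD1set.
split=> //; last first.
  rewrite (leq_trans cB') // (leq_trans (leq_add Bn (leqnn b))) //.
  by rewrite -mulnSr leq_mul2l prog orbT.
(* A non-dangerous [v] is below [threshold]. A dangerous one other than [z] gained at most one edge,
   paid by the growth of [secured]; if it is [z], it is also [a], whose new edge in [F'] pays
   [b]. *)
move=> v dv; have [vB'|] := boolP (v \in dangerous B'); last first.
  by rewrite inE -ltnNge => h; rewrite (leq_trans h) // -!addnA leq_addr.
have dFv := monoD v vB'; have dFv2 := leq_ltn_trans dFv dv.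
have bd := Bd v dFv2.
have [vz|vz] := eqVneq v z; last first.
  rewrite (leq_ltn_trans (leaf v vz)) // addn1 (leq_ltn_trans bd) //.
  by rewrite -addSn leq_add ?leq_mul2l ?dFv ?orbT // -addnS leq_add2l.
have va : v = a by rewrite za ?vz // -?vz dFv2.
rewrite (leq_ltn_trans (centre v)) // -addSn (leq_trans (leq_add bd (leqnn b))) //.
rewrite -addnA -mulnSr leq_add ?leq_add2l ?(ltnW sec) //.
by rewrite leq_mul2l va monoa orbT.
Qed.

(* Once Maker owns [e], completing either [e1] or [e2] gains an edge; these are
   disjoint, so no star contains both. *)
Lemma quiet_step F p B x y A D :
  arranged F p -> p = A ++ x :: y :: D -> [set x; y] \notin F ->
  (forall v, deg F v < 2 -> v \notin dangerous B) ->
  exists (e e1 e2 : {set 'I_n}) F1 F2 q1 q2,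
    [/\ #|e| = 2, #|e1| = 2, #|e2| = 2 & [disjoint e1 & e2]] /\
    [/\ e \notin B, e1 \notin B & e2 \notin B] /\
    [/\ F1 \subset e1 |: (e |: F), arranged F1 q1, #|F| < #|F1| &
        forall v, deg F v <= deg F1 v] /\
    [/\ F2 \subset e2 |: (e |: F), arranged F2 q2, #|F| < #|F2| &
        forall v, deg F v <= deg F2 v].
Proof.
move=> Fp pE xyF quiet.
(* Cut at the missing link and let [P] be the longer part, so that it has at least half of the
   vertices. *)
have [P [Q [FPQ Fl PQ]]] : exists P Q, [/\ arranged F (P ++ Q),
    {subset F <= links P ++ links Q} & 0 < size Q <= size P].
  have Fl : {subset F <= links (rcons A x) ++ links (y :: D)}.
    move=> e eF; case: Fp => _ _ /(_ e eF); rewrite pE links_cat !mem_cat inE.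
    by case/or3P=> [->//|/eqP ee|->]; rewrite ?orbT //; rewrite -ee eF in xyF.
  rewrite pE -cat_rcons in Fp.
  have [le|le] := leqP (size (y :: D)) (size (rcons A x)).
    by exists (rcons A x), (y :: D).
  exists (y :: D), (rcons A x); split; first exact: arranged_rot Fl.
    by move=> e /Fl; rewrite !mem_cat orbC.
  by rewrite (ltnW le) size_rcons.
have szPQ := arranged_size FPQ; rewrite size_cat in szPQ.
have [Q' [a QE]] : exists Q' a, Q = rcons Q' a.
  by case/lastP: Q PQ {FPQ Fl szPQ} => // Q' a; exists Q', a.
have [h [mid [l PE]]] : exists h mid l, P = h :: rcons mid l.
  case: P PQ szPQ {FPQ Fl} => [|h P]; first by case: (size Q).
  case/lastP: P => [/andP[_ /= le] szPQ|mid l]; last by exists h, mid, l.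
  by move: (size Q) le szPQ; lia.
subst P Q.
have low v : deg F v <= 1 -> deg B v < threshold.
  by move=> dv; have := quiet v dv; rewrite inE -ltnNge.
have ah : deg F h <= 1 by apply: (@deg_head _ _ _ (rcons mid l ++ rcons Q' a)).
have aa : deg F a <= 1.
  by apply: (@deg_last _ _ _ ((h :: rcons mid l) ++ Q')); rewrite rcons_cat.
have al : deg F l <= 1.
  apply: (@deg_last _ _ _ (rcons Q' a ++ h :: mid)).
  by rewrite rcons_cat; exact: arranged_rot Fl.
have {ah}dh := low _ ah; have {aa}da := low _ aa; have {al}dl := low _ al.
have [uPQ _ _] := FPQ.
have umid : uniq mid.
  by move: uPQ; rewrite cat_uniq /= rcons_uniq => /and3P[/and3P[]].
(* The three forbidden sets have fewer than [n / 10] vertices each, while [mid] has at least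
   [n / 2 - 2]. *)
have [|X [u [c [v [Y [midE [ul ca vh]]]]]]] :=
  @consecutive_avoiding _ mid (nbrs B l) (nbrs B a) (nbrs B h) umid.
  have nl v := leq_ltn_trans (card_nbrs B v).
  apply: (@leq_ltn_trans (threshold + threshold + threshold + 2)).
    by rewrite leq_add2r !leq_add // ltnW // nl.
  by move: PQ szPQ; rewrite /= !size_rcons /threshold; lia.
rewrite inE in ul; rewrite inE in ca; rewrite inE in vh.
have E1 : h :: rcons mid l = h :: X ++ u :: c :: v :: rcons Y l.
  by rewrite midE rcons_cat.
have E2 : rev (h :: rcons mid l) = l :: rev Y ++ v :: c :: u :: rcons (rev X) h.
  by rewrite E1 rev_cons rev_cat !rev_cons rev_rcons /= -!cats1 -!catA.
(* Reversing the first part swaps [h] with [l] and [u] with [v], so the same exchange lemma yields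
   the second option. *)
have FPQ' : arranged F (rev (h :: rcons mid l) ++ rcons Q' a).
  apply: (arranged_perm FPQ); first by rewrite perm_cat2r perm_sym perm_rev.
  move=> e /Fl; rewrite mem_cat => /orP[eP|]; last exact: links_catr.
  by apply: links_catl; rewrite links_rev.
have Fl' : {subset F <= links (rev (h :: rcons mid l)) ++ links (rcons Q' a)}.
  by move=> e /Fl; rewrite !mem_cat links_rev.
have uP : uniq (h :: rcons mid l) by move: uPQ; rewrite cat_uniq => /and3P[].
rewrite E1 in FPQ Fl; rewrite E2 in FPQ' Fl'.
have [G1 acF hvF ne1] := arranged_insert FPQ Fl.
have [G2 _ luF ne2] := arranged_insert FPQ' Fl'.
have [m1 c1] := exchange_improves acF hvF ne1.
have [m2 c2] := exchange_improves acF luF ne2.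
have ac : a != c.
  apply/eqP=> ac; move: uPQ; rewrite cat_uniq => /and3P[_ /hasPn/(_ a)].
  by rewrite mem_rcons inE eqxx /= E1 ac !inE mem_cat !inE eqxx !orbT => /(_ isT).
move: uP; rewrite E1 /= cat_uniq /= !(mem_cat, inE, mem_rcons) !negb_or => uP.
have [hv hu hl] : [/\ h != v, h != u & h != l].
  by case/andP: uP => /and5P[_ -> _ -> /andP[-> _]] _.
have [lu lv uv] : [/\ l != u, l != v & u != v].
  move: uP => /andP[_] /and3P[_ _] /and4P[/and4P[_ -> ul' _] _ /andP[vl _] _].
  by rewrite eq_sym ul' eq_sym vl.
have sub e f g : e |: (f |: (F :\ g)) \subset f |: (e |: F).
  by rewrite setUCA; do 2 apply: setUS; exact: subD1set.
exists [set a; c], [set h; v], [set l; u].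
exists ([set a; c] |: ([set h; v] |: (F :\ [set c; v]))).
exists ([set a; c] |: ([set l; u] |: (F :\ [set c; u]))).
do 2 eexists; split; [|split; [by split|split; split]].
- split; rewrite ?cards2 ?ac ?hv ?lu //.
  apply/pred0P=> w; rewrite !inE; apply/negP=> /andP[/orP[]/eqP-> /orP[]/eqP E].
  + by rewrite E eqxx in hl.
  + by rewrite E eqxx in hu.
  + by rewrite E eqxx in lv.
  + by rewrite E eqxx in uv.
- exact: sub.
- exact: G1.
- exact: c1.
- exact: m1.
- exact: sub.
- exact: G2.
- exact: c2.
- exact: m2.
Qed.

Lemma breaker_move_star M B S : breaker_move b M B S -> star S.
Proof. by case=> SU Sb zS; split=> //; exact: subset_trans SU (subsetDl _ _). Qed.

(** Induction on [4 * n - progress F B]. The invariant [safe] refers to the position before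
    Breaker's last star [S]; [M] may exceed [F], as rearranging drops edges that Maker still
    owns. *)
Lemma maker_turn_wins F p M B S :
  arranged F p -> F \subset M -> safe F B -> star S ->
  maker_wins b Maker M (S :|: B).
Proof.
have [k] := ubnP (4 * n - progress F B).
elim: k F p M B S => // k IH F p M B S; rewrite ltnS => lek Fp FM sB stS.
have v0 : 'I_n by exists 0; lia.
have next F' q M' B' S' : arranged F' q -> F' \subset M' -> safe F' B' ->
    progress F B < progress F' B' -> breaker_move b M' B' S' ->
    maker_wins b Maker M' (S' :|: B').
  move=> F'q F'M' sB' prog /breaker_move_star stS'.
  by apply: (IH _ _ _ _ _ _ F'q) => //; have := progress_le B' F'q; lia.
have [srt|[A [x [y [D [pE xyM]]]]]] := sorted_splitP (fun x y => [set x; y] \in M) p.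
  by apply: ham_path_maker_wins; exists p; case: Fp.
have xyF : [set x; y] \notin F by apply: contra xyM; exact: (subsetP FM).
case: (boolP [exists v, (deg F v < 2) && (v \in dangerous (S :|: B))]).
  move=> /existsP/(dangerous_step Fp sB stS).
  move=> [e [F' [q [[eB e2 F'e F'q] [sB' prog]]]]].
  apply: (maker_claim v0 e2 eB) => S' mS'; apply: (next _ _ _ _ _ F'q) => //.
  exact: subset_trans F'e (setUS _ FM).
move=> /existsPn quiet.
have [|e [e1 [e2 [F1 [F2 [q1 [q2 H]]]]]]] := @quiet_step F p (S :|: B) x y A D Fp pE xyF.
  by move=> v dv; have := quiet v; rewrite dv.
case: H => [[ce ce1 ce2 dis] [[eB e1B e2B] [[F1e F1q cF1 mF1] [F2e F2q cF2 mF2]]]].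
apply: (maker_claim v0 ce eB) => S1 mS1.
have [S1c S1b [z zS1]] := breaker_move_star mS1.
case: sB stS => Bc Bd Bn [Sc Sb _].
set B1 := S1 :|: (S :|: B).
have BB1 : B \subset B1 by rewrite /B1 setUA subsetUr.
(* The stars [S] and [S1] bring at most [2 * b] edges, paid by the new edge of [F'], which counts
   twice in [progress]. By [quiet] the ends are below [threshold] before [S1], which adds at most
   the single [b] in [safe]. *)
have finish (f : {set 'I_n}) F' q : #|f| = 2 -> f \notin B1 -> F' \subset f |: (e |: F) ->
    arranged F' q -> #|F| < #|F'| -> (forall v, deg F v <= deg F' v) ->
    maker_wins b Maker (e |: M) B1.
  move=> f2 fB1 F'f F'q cF' mF'; apply: (maker_claim v0 f2 fB1) => S2 mS2.
  have sec : secured F B <= secured F' B1 by exact: secured_leq.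
  have prog : progress F B + 2 <= progress F' B1.
    by rewrite /progress -addnA leq_add // -mulnSr leq_mul2l cF'.
  apply: (next _ _ _ _ _ F'q) => //.
  - by apply: subset_trans F'f _; do 2 apply: setUS.
  - split.
    + by rewrite !subUset S1c Sc.
    + move=> v dv; have := quiet v; rewrite (leq_ltn_trans (mF' v) dv) /= inE -ltnNge.
      have := deg_leU S1 (S :|: B) v; rewrite -/B1.
      have := leq_trans (deg_leq_card S1 v) S1b => d1 d2 d3.
      rewrite -!addnA (leq_ltn_trans d2) // addnC -addSn leq_add //.
      by rewrite (leq_trans d1) // leq_addr.
    + have h1 := (leq_card_setU S1 (S :|: B)).1; rewrite -/B1 in h1.
      have h2 := (leq_card_setU S B).1.
      have h3 : #|B1| <= b + (b + #|B|).
        by rewrite (leq_trans h1) // leq_add // (leq_trans h2) // leq_add2r.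
      rewrite (leq_trans h3) // (@leq_trans (b * (progress F B + 2))) //.
        by rewrite mulnDr muln2 -addnn addnA addnC leq_add2r.
      by rewrite leq_mul2l prog orbT.
  - by rewrite (leq_trans _ prog) // addn2.
have [e1B1|e1B1] := boolP (e1 \in B1); last exact: (finish e1 F1 q1).
apply: (finish e2 F2 q2) => //; rewrite /B1 inE (negPf e2B) orbF.
apply/negP=> e2S1; move: e1B1; rewrite inE (negPf e1B) orbF => e1S1.
have /pred0P/(_ z) := dis; rewrite /= (zS1 _ e1S1) (zS1 _ e2S1) //.
Qed.

Lemma maker_wins_small first : maker_wins_ham first b n.
Proof.
pose p := enum 'I_n; have v0 : 'I_n by exists 0; lia.
have Fp : arranged (set0 : graph n) p.
  by split=> [|v|e]; rewrite ?enum_uniq ?mem_enum ?inE.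
have deg0 v : deg (set0 : graph n) v = 0.
  by apply/eqP; rewrite cards_eq0; apply/eqP/setP=> e; rewrite !inE.
have s0 : safe set0 set0.
  split=> [|v|]; rewrite ?sub0set ?cards0 //.
  by rewrite deg0 => _; rewrite /threshold; lia.
have win S : star S -> maker_wins b Maker (set0 : graph n) (S :|: set0).
  by move=> stS; apply: maker_turn_wins Fp _ s0 stS; rewrite sub0set.
(* Maker moving first amounts to an empty first star of Breaker. *)
have win0 : maker_wins b Maker (set0 : graph n) set0.
  by have := win _ (breaker_move_star (breaker_move0 b v0 set0 set0)); rewrite set0U.
case: first => //; apply: MakerWinsBreaker.
  have l0 : 0 < n by lia. have l1 : 1 < n by lia.
  by apply/set0Pn; exists [set Ordinal l0; Ordinal l1]; rewrite !inE cards2.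
by move=> S /breaker_move_star; exact: win.
Qed.

End Strategy.

(** * Existence and order of magnitude of the threshold *)

Lemma threshold_bias_linear first n :
  1000 <= n -> exists b0, is_threshold_bias first n b0 /\ n <= 2000 * b0 <= 2000 * n.
Proof.
move=> n_ge.
(* The threshold is one less than the least bias in [P]. The first condition builds the lower bound
   into this minimum; up to [n %/ 1000] the explicit strategy wins for Maker. *)
pose P b := (n %/ 1000 < b) && boolp.asbool (breaker_wins_ham first b n).
have exP : exists b, P b.
  exists n; apply/andP; split; first by lia.
  by apply/boolp.asboolP; apply: breaker_wins_large => //; lia.
case: (ex_minnP exP) => m /andP[m_gt /boolp.asboolP m_wins] m_min.
have m_le : m <= n.
  apply: m_min; apply/andP; split; first by lia.
  by apply/boolp.asboolP; apply: breaker_wins_large => //; lia.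
exists m.-1; split; last by lia.
move=> b; split=> [mb|bm].
  by apply: breaker_winsW m_wins; lia.
have [le|gt] := leqP b (n %/ 1000); first by apply: maker_wins_small => //; lia.
case: (@determinacy n b first set0 set0) => [|//|W]; first by lia.
have : m <= b by apply: m_min; rewrite /P gt; exact/boolp.asboolP.
by lia.
Qed.

From mathcomp Require Import all_order all_algebra.
From mathcomp Require Import all_classical all_reals all_analysis.
Import Order.TTheory GRing.Theory Num.Theory numFieldNormedType.Exports.
Local Open Scope classical_set_scope.
Local Open Scope ring_scope.

Theorem theorem5p4 (R : realType) (first : player) :
  exists b0 : nat -> nat,
    (\forall n \near \oo, is_threshold_bias first n (b0 n)) /\
    (fun n : nat => (b0 n)%:R : R^o) =Theta_\oo (fun n : nat => n%:R : R^o).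
Proof.
have [n|b0 b0P] := @choice _ _ (fun n m => (1000 <= n)%N ->
    is_threshold_bias first n m /\ (n <= 2000 * m <= 2000 * n)%N).
  have [n_ge|n_lt] := leqP 1000 n; last by exists 0%N.
  by have [m mP] := threshold_bias_linear first n_ge; exists m.
have large : \forall n \near \oo, (1000 <= n)%N by exact: nbhs_infty_ge.
exists b0; split; first by near=> n; apply: (b0P n _).1; near: n.
(* The constants come from [n <= 2000 * b0 n] and [b0 n <= n]. *)
rewrite eqThetaE qualifE; apply/asboolP; exists (2000^-1, 1) => /=.
  by rewrite ltr01 invr_gt0 ltr0n.
near=> n; have [|_ /andP[nb bn]] := b0P n; first by near: n.
rewrite !normr_nat mul1r; split.
  by rewrite ler_pdivrMl ?ltr0n // -natrM ler_nat.
by rewrite ler_nat -(leq_pmul2l (isT : (0 < 2000)%N)).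
Unshelve. all: by end_near. Qed.
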